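(* Let $A,B\in\mathbb{R}^{m\times m}$ be symmetric matrices with $A$ nonsingular. Then $\{A,B\}$ is TWSD-B if and only if $A^{-1}B$ has only real eigenvalues.
   Context: $\mathrm{SL}_m(\mathbb{R})$ is the group of real $m\times m$ matrices with determinant $1$; $\|\cdot\|$ is the Frobenius norm. A set $\{A_1,\dots,A_L\}$ of real symmetric $m\times m$ matrices is TWSD-B (bounded transformation based weakly simultaneously diagonalizable) if there exist $P_k\in\mathrm{SL}_m(\mathbb{R})$ and diagonal matrices $D_k^{(1)},\dots,D_k^{(L)}\in\mathbb{R}^{m\times m}$ for $k\ge 1$ such that $\lim_{k\to\infty}\sum_{i=1}^L\|P_kA_iP_k^{\mathsf T}-D_k^{(i)}\|^2=0$ and $\|D_k^{(i)}\|$ is bounded uniformly in $i$ and $k$. *)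

(* Defs.v *)
From HB Require Import structures.
From mathcomp Require Import all_boot all_order all_algebra.
From mathcomp Require Import all_classical all_reals all_analysis.
From mathcomp Require Import complex.

Set Implicit Arguments.
Unset Strict Implicit.
Unset Printing Implicit Defensive.

Import Order.TTheory GRing.Theory Num.Theory.
Import numFieldNormedType.Exports.

Local Open Scope classical_set_scope.
Local Open Scope ring_scope.

(* The norm `|M| that mathcomp-analysis puts on matrices is the max norm, hence
   this separate definition. *)
Definition frobenius_norm (R : realType) (m n : nat) (M : 'M[R]_(m, n)) : R :=
  Num.sqrt (\sum_(i < m) \sum_(j < n) M i j ^+ 2).

(* The set {A_1, ..., A_L} is given as a tuple, intended to consist of symmetric
   matrices; P_k is indexed from k = 0 instead of k = 1. *)
Definition TWSDB (R : realType) (m L : nat) (A : L.-tuple 'M[R]_m) : Prop :=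
  exists (P : nat -> 'M[R]_m) (D : nat -> 'I_L -> 'M[R]_m),
    [/\ forall k, \det (P k) = 1,
        forall k i, is_diag_mx (D k i),
        (fun k => \sum_(i < L)
           frobenius_norm (P k *m tnth A i *m (P k)^T - D k i) ^+ 2)
          @ \oo --> (0 : R)
      & exists M : R, forall k i, frobenius_norm (D k i) <= M].

(* [eigenvalue] only sees eigenvalues in the coefficient field, so a real matrix
   is first mapped into R[i]. *)
Definition only_real_eigenvalues (R : realType) (m : nat) (M : 'M[R]_m) : Prop :=
  forall z : R[i],
    eigenvalue (map_mx (real_complex R) M) z -> z \is Num.real.

(* Main.v *)
Require Import Defs.
From mathcomp Require Import all_boot all_order all_algebra.
From mathcomp Require Import all_classical all_reals all_analysis.
From mathcomp Require Import perm complex zify ring lra.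

Set Implicit Arguments.
Unset Strict Implicit.
Unset Printing Implicit Defensive.

Import Order.TTheory GRing.Theory Num.Theory.
Import numFieldNormedType.Exports.

Local Open Scope ring_scope.

(** Everything is read off the determinant [pencil_det z A B] of z A - B: since
    A is nonsingular, its complex roots z are the eigenvalues of A^-1 B, and a
    congruence by P multiplies it by (det P)^2, so P in SL_m leaves it alone.

    Necessity. For diagonal D1, D2 this determinant is the product of the
    z d1_i - d2_i, whose imaginary parts are Im z * d1_i; its modulus is
    therefore at least |Im z|^m |det D1| ([pencil_det_diag]). The determinant
    is Lipschitz on bounded sets, so the estimate passes to the limit and gives
    |det (z A - B)| >= |Im z|^m |det A|, which forbids nonreal roots
    ([TWSDB_real_pencil]).

    Sufficiency. Say that (A, B) degenerates to (A', B') when the latter lies in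
    the closure of the orbit of the former under simultaneous congruence by
    SL_m. A pair with real eigenvalues degenerates to a diagonal pair
    ([diagonal_degeneration_of_real_pencil]), which then serves as a constant,
    hence bounded, sequence of diagonal matrices. The proof is by induction on
    the size, starting from u <> 0 with u B = l u A. If u A u^T <> 0, the line
    of u and its A-orthogonal complement are also B-orthogonal, and the pair
    splits into blocks of sizes 1 and m - 1
    ([diagonal_degeneration_anisotropic]). If u A u^T = 0, take a basis u, w, U
    with U spanning, together with u, the A-orthogonal of u. Scaling u by t and
    w by 1/t and letting t grow kills everything but the pairing of u with w
    and the block of U, because u pairs to zero with u and U under both forms.
    In the limit u + w is an eigenvector for the same l, and it is no longer
    isotropic ([isotropic_degenerates_anisotropic]), so the first case applies;
    its hypotheses survive since degeneration preserves [pencil_det] and the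
    determinant of A. *)

(** * Entrywise bounds and continuity of the determinant *)

Definition bounded_mx (F : numDomainType) m n (K : F) (X : 'M[F]_(m, n)) :=
  forall i j, `|X i j| <= K.

Definition close_mx (F : numDomainType) m n (e : F) (X Y : 'M[F]_(m, n)) :=
  forall i j, `|X i j - Y i j| <= e.

Lemma exists_bounded_mx (F : numDomainType) m n (X : 'M[F]_(m, n)) :
  exists2 K, 0 <= K & bounded_mx K X.
Proof.
exists (\sum_i \sum_j `|X i j|) => [|i j].
  by do 2!apply: sumr_ge0 => ? _.
rewrite (bigD1 i) //= (bigD1 j) //= -addrA lerDl addr_ge0 ?sumr_ge0 // => *.
exact: sumr_ge0.
Qed.

Lemma bounded_close_mx (F : numDomainType) m n (K e : F) (X Y : 'M[F]_(m, n)) :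
  bounded_mx K Y -> close_mx e X Y -> bounded_mx (K + e) X.
Proof.
move=> bY XY i j; rewrite -[X i j](subrK (Y i j)) addrC.
by rewrite (le_trans (ler_normD _ _)) // lerD.
Qed.

Lemma bounded_mxB (F : numDomainType) m n (e : F) (X Y : 'M[F]_(m, n)) :
  close_mx e X Y -> bounded_mx e (X - Y).
Proof. by move=> XY i j; rewrite !mxE. Qed.

Lemma bounded_mxW (F : numDomainType) m n (K L : F) (X : 'M[F]_(m, n)) :
  K <= L -> bounded_mx K X -> bounded_mx L X.
Proof. by move=> KL bX i j; apply: le_trans KL. Qed.

(** Telescoping: the factors are replaced one at a time, each replacement costing
    e times a product of factors bounded by K; 1 <= K bounds the shorter
    products by the longer ones. *)
Lemma dist_prod_le (F : numDomainType) (K e : F) n (a b : 'I_n -> F) :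
    1 <= K -> (forall i, `|a i| <= K) -> (forall i, `|b i| <= K) ->
    (forall i, `|a i - b i| <= e) ->
  `|\prod_i a i - \prod_i b i| <= K ^+ n * (n%:R * e).
Proof.
move=> K1; have K0 : 0 <= K by apply: le_trans K1.
elim: n a b => [|n IHn] a b aK bK ab.
  by rewrite !big_ord0 subrr normr0 mul0r mulr0.
have e0 : 0 <= e by apply: le_trans (ab ord0).
have prodK : `|\prod_(i < n) a (lift ord0 i)| <= K ^+ n.
  rewrite normr_prod -[n in K ^+ n]card_ord -prodr_const ler_prod // => i _.
  by rewrite normr_ge0 aK.
rewrite !big_ord_recl; set p := \prod_i _ in prodK *; set q := \prod_i _.
have -> : a ord0 * p - b ord0 * q = (a ord0 - b ord0) * p + b ord0 * (p - q) by ring.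
apply: le_trans (ler_normD _ _) _; rewrite !normrM.
have -> : K ^+ n.+1 * (n.+1%:R * e) = e * K ^+ n.+1 + K * (K ^+ n * (n%:R * e)).
  by rewrite -natr1 exprS; ring.
apply: lerD; last by apply: ler_pM => //; apply: IHn => i.
by apply: ler_pM => //; rewrite (le_trans prodK) // exprS ler_peMl // exprn_ge0.
Qed.

Lemma det_lipschitz (F : numDomainType) n (K : F) : 0 <= K ->
  exists2 C, 0 <= C & forall (X Y : 'M[F]_n) e,
    bounded_mx K X -> bounded_mx K Y -> close_mx e X Y ->
    `|\det X - \det Y| <= C * e.
Proof.
move=> K0; exists (#|'S_n|%:R * ((K + 1) ^+ n * n%:R)).
  by rewrite !mulr_ge0 // exprn_ge0 // addr_ge0.
move=> X Y e bX bY XY; rewrite /determinant -sumrB.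
apply: le_trans (ler_norm_sum _ _ _) _.
rewrite -!mulrA mulr_natl -sumr_const; apply: ler_sum => s _.
rewrite -mulrBr normrM normrX normrN1 expr1n mul1r.
by apply: dist_prod_le => [|i|i|i] //; rewrite ?lerDr // ler_wpDr.
Qed.

(** With x > 0 one would have C > 0, and e = x / (C + x) contradicts the
    hypothesis. *)
Lemma le0_of_le_scaled_eps (R : realFieldType) (x C : R) :
  (forall e, 0 < e -> e <= 1 -> x <= C * e) -> x <= 0.
Proof.
move=> xC; rewrite leNgt; apply/negP => x0.
have C0 : 0 < C by have := xC 1 ltr01 (lexx _); rewrite mulr1; apply: lt_le_trans.
have d0 : 0 < C + x by rewrite addr_gt0.
have := xC (x / (C + x)) (divr_gt0 x0 d0).
rewrite ler_pdivrMr // mul1r mulrA ler_pdivlMr // => /(_ _).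
have := mulr_gt0 x0 x0; nra.
Qed.

(** * The determinant of a pencil *)

Section Pencil.
Variable R : rcfType.
Implicit Types z : R[i].

Definition pencil_det m z (A B : 'M[R]_m) : R[i] :=
  \det (z *: map_mx (real_complex R) A - map_mx (real_complex R) B).

Lemma normc_real (x : R) : `|real_complex R x| = real_complex R `|x|.
Proof. by rewrite normc_def /= expr0n addr0 sqrtr_sqr. Qed.

Lemma normc_ge_Im z : real_complex R `|complex.Im z| <= `|z|.
Proof. by rewrite normc_def lecR -sqrtr_sqr ler_wsqrtr // lerDr sqr_ge0. Qed.

(** The constant is real although the determinants are complex, so that it can be
    combined with the estimates over R. *)
Lemma pencil_det_lipschitz m z (K : R) : 0 <= K ->
  exists C : R, forall (A B A' B' : 'M[R]_m) e,
    bounded_mx K A -> bounded_mx K B -> bounded_mx K A' -> bounded_mx K B' ->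
    close_mx e A A' -> close_mx e B B' ->
    `|pencil_det z A B - pencil_det z A' B'| <= real_complex R (C * e).
Proof.
move=> K0; pose iota := real_complex R.
have scale_bound (t a b : R) : `|a| <= t -> `|b| <= t ->
    `|z * iota a - iota b| <= (`|z| + 1) * iota t.
  move=> at_ bt; rewrite (le_trans (ler_normB _ _)) // normrM !normc_real.
  rewrite mulrDl mul1r; apply: lerD; last by rewrite lecR.
  by apply: ler_wpM2l => //; rewrite lecR.
have [|C C0 detC] := @det_lipschitz R[i] m ((`|z| + 1) * iota K).
  by apply: mulr_ge0; [exact: addr_ge0 | rewrite ler0c].
have rC : C * (`|z| + 1) \is Num.real.
  by apply: ger0_real; apply: mulr_ge0 => //; apply: addr_ge0.
exists (complex.Re (C * (`|z| + 1))) => A B A' B' e bA bB bA' bB' AA' BB'.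
rewrite rmorphM /= RRe_real // -mulrA; apply: detC => i j; rewrite !mxE.
- exact: scale_bound.
- exact: scale_bound.
set x := _ - _; suff -> : x = z * iota (A i j - A' i j) - iota (B i j - B' i j).
  exact: scale_bound.
by rewrite /x /iota !rmorphB /=; ring.
Qed.

Lemma pencil_det_congr m z (Q A B : 'M[R]_m) :
  pencil_det z (Q *m A *m Q^T) (Q *m B *m Q^T) =
  real_complex R (\det Q) ^+ 2 * pencil_det z A B.
Proof.
rewrite /pencil_det !map_mxM scalemxAl scalemxAr -mulmxBl -mulmxBr.
by rewrite !det_mulmx -map_trmx det_tr det_map_mx /=; ring.
Qed.

(** Each factor satisfies |z d1 - d2| >= |Im (z d1 - d2)| = |Im z| |d1|. *)
Lemma pencil_det_diag m z (D1 D2 : 'M[R]_m) : is_diag_mx D1 -> is_diag_mx D2 ->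
  real_complex R (`|complex.Im z| ^+ m * `|\det D1|) <= `|pencil_det z D1 D2|.
Proof.
move=> /diag_mxP[d1 ->] /diag_mxP[d2 ->].
rewrite /pencil_det !map_diag_mx -linearZ -linearB /= !det_diag !normr_prod.
rewrite -[m in _ ^+ m]card_ord -prodr_const -big_split /= rmorph_prod.
apply: ler_prod => i _; rewrite ler0c mulr_ge0 //= !mxE -normrM.
apply: le_trans (normc_ge_Im _); rewrite lecR.
suff -> : complex.Im (z * (d1 0 i)%:C%C - (d2 0 i)%:C%C) = complex.Im z * d1 0 i by [].
by case: z => a b; rewrite /= !mulr0 add0r subr0.
Qed.

End Pencil.

(** * Degeneration under simultaneous congruence *)

Section Degeneration.
Variable R : rcfType.

(** The pair (A', B') lies in the closure of the orbit of (A, B) under the action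
    of SL_m by simultaneous congruence. *)
Definition degenerates m (A B A' B' : 'M[R]_m) := forall e, 0 < e ->
  exists P : 'M[R]_m, [/\ \det P = 1, close_mx e (P *m A *m P^T) A'
                        & close_mx e (P *m B *m P^T) B'].

(** Continuity of congruence by S, which is what makes degeneration transitive. *)
Lemma close_mx_congr m (S : 'M[R]_m) (e : R) : 0 < e ->
  exists2 d, 0 < d & forall X Y, close_mx d X Y ->
    close_mx e (S *m X *m S^T) (S *m Y *m S^T).
Proof.
move=> e0; have [K K0 bS] := exists_bounded_mx S.
pose c := \sum_(i < m) \sum_(j < m) (K * K); have c0 : 0 <= c.
  by do 2!apply: sumr_ge0 => ? _; apply: mulr_ge0.
exists (e / (c + 1)) => [|X Y XY i j]; first by rewrite divr_gt0 // ltr_wpDl.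
suff le_c : `|(S *m (X - Y) *m S^T) i j| <= c * (e / (c + 1)).
  have -> : (S *m X *m S^T) i j - (S *m Y *m S^T) i j = (S *m (X - Y) *m S^T) i j.
    by rewrite mulmxBr mulmxBl !mxE.
  apply: le_trans le_c _; rewrite mulrA ler_pdivrMr ?ltr_wpDl //.
  by rewrite mulrDr mulr1 mulrC lerDl ltW.
rewrite mxE (le_trans (ler_norm_sum _ _ _)) // mulr_suml ler_sum // => k _.
rewrite mxE normrM mulr_suml (le_trans (ler_wpM2r _ (ler_norm_sum _ _ _))) //.
rewrite mulr_suml ler_sum // => l _.
by rewrite !mxE normrM mulrAC; do 2?[apply: ler_pM => //].
Qed.

Lemma degenerates_refl m (A B : 'M[R]_m) : degenerates A B A B.
Proof.
move=> e e0; exists 1%:M; rewrite trmx1 !mulmx1 !mul1mx det1; split=> // i j.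
  by rewrite subrr normr0 ltW.
by rewrite subrr normr0 ltW.
Qed.

Lemma degenerates_trans m (A B A' B' A'' B'' : 'M[R]_m) :
  degenerates A B A' B' -> degenerates A' B' A'' B'' -> degenerates A B A'' B''.
Proof.
move=> AA' AA'' e e0; have e2 : 0 < e / 2 by rewrite divr_gt0.
have [P [detP PA PB]] := AA'' _ e2.
have [d d0 dP] := close_mx_congr P e2.
have [S [detS SA SB]] := AA' _ d0.
have step X X' X'' : close_mx d (S *m X *m S^T) X' ->
    close_mx (e / 2) (P *m X' *m P^T) X'' ->
    close_mx e (P *m S *m X *m (P *m S)^T) X''.
  move=> /dP SX PX i j; have := lerD (SX i j) (PX i j); rewrite -splitr.
  by apply: le_trans; rewrite trmx_mul !mulmxA -(subrKA ((P *m X' *m P^T) i j)) ler_normD.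
exists (P *m S); split; [by rewrite det_mulmx detP detS mulr1 | |].
  exact: step PA.
exact: step PB.
Qed.

(** Q may have any nonzero determinant as long as S compensates for it: the
    approximating matrices are S P Q. This allows bases to be chosen without
    normalising their volume. *)
Lemma degenerates_congr m (S Q A B A' B' : 'M[R]_m) : \det (S *m Q) = 1 ->
    degenerates (Q *m A *m Q^T) (Q *m B *m Q^T) A' B' ->
  degenerates A B (S *m A' *m S^T) (S *m B' *m S^T).
Proof.
move=> detSQ AA' e e0; have [d d0 dS] := close_mx_congr S e0.
have [P [detP PA PB]] := AA' _ d0.
exists (S *m P *m Q); split.
- by rewrite !det_mulmx detP mulr1 -det_mulmx.
- by have := dS _ _ PA; rewrite !trmx_mul !mulmxA.
- by have := dS _ _ PB; rewrite !trmx_mul !mulmxA.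
Qed.

Lemma degenerates_block m n (A1 B1 A1' B1' : 'M[R]_m) (A2 B2 A2' B2' : 'M[R]_n) :
    degenerates A1 B1 A1' B1' -> degenerates A2 B2 A2' B2' ->
  degenerates (block_mx A1 0 0 A2) (block_mx B1 0 0 B2)
              (block_mx A1' 0 0 A2') (block_mx B1' 0 0 B2').
Proof.
move=> d1 d2 e e0; have [P1 [det1 PA1 PB1]] := d1 _ e0.
have [P2 [det2 PA2 PB2]] := d2 _ e0.
pose P := block_mx P1 0 0 P2.
have congr_block X1 X2 : P *m block_mx X1 0 0 X2 *m P^T =
    block_mx (P1 *m X1 *m P1^T) 0 0 (P2 *m X2 *m P2^T).
  by rewrite tr_block_mx !mulmx_block !trmx0 !(mul0mx, mulmx0, addr0, add0r).
have close_block X1 X2 Y1 Y2 : close_mx e X1 Y1 -> close_mx e X2 Y2 ->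
    close_mx e (block_mx X1 0 0 X2) (block_mx Y1 0 0 Y2).
  move=> XY1 XY2 i j; rewrite -[ i]splitK -[j]splitK.
  case: (fintype.split i) => k; case: (fintype.split j) => l /=;
    by rewrite ?block_mxEul ?block_mxEur ?block_mxEdl ?block_mxEdr // !mxE subrr normr0 ltW.
exists P; split.
- by rewrite det_ublock det1 det2 mulr1.
- by rewrite congr_block; apply: close_block.
- by rewrite congr_block; apply: close_block.
Qed.

(** The pencil determinant is constant on SL_m-orbits and continuous, hence
    constant on their closures. *)
Lemma pencil_det_degenerates m (A B A' B' : 'M[R]_m) z :
  degenerates A B A' B' -> pencil_det z A B = pencil_det z A' B'.
Proof.
move=> AA'; have [KA KA0 bA] := exists_bounded_mx A'.
have [KB KB0 bB] := exists_bounded_mx B'; pose K := KA + KB + 1.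
have KK : (KA <= K) * (KB <= K) by rewrite /K; split; lra.
have K0 : 0 <= K by rewrite (le_trans KA0) ?KK.
have [C lipC] := pencil_det_lipschitz m z K0.
apply/eqP; rewrite -subr_eq0 -normr_eq0 normc_def.
set x := Num.sqrt _; suff -> : x = 0 by [].
apply/eqP; rewrite eq_le sqrtr_ge0 andbT.
apply: (@le0_of_le_scaled_eps _ _ C) => e e0 e1.
have [P [detP PA PB]] := AA' _ e0.
rewrite -lecR -normc_def.
have <- : pencil_det z (P *m A *m P^T) (P *m B *m P^T) = pencil_det z A B.
  by rewrite pencil_det_congr detP expr1n mul1r.
apply: lipC => //.
- by apply: bounded_mxW (bounded_close_mx bA PA); rewrite /K; lra.
- by apply: bounded_mxW (bounded_close_mx bB PB); rewrite /K; lra.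
- exact: bounded_mxW KK.1 bA.
- exact: bounded_mxW KK.2 bB.
Qed.

Lemma pencil_det0r m (A : 'M[R]_m) : pencil_det 1 A 0 = real_complex R (\det A).
Proof. by rewrite /pencil_det map_mx0 subr0 scale1r det_map_mx. Qed.

(** This is the previous invariance at z = 1 for the pairs (A, 0) and (A', 0). *)
Lemma det_degenerates m (A B A' B' : 'M[R]_m) :
  degenerates A B A' B' -> \det A = \det A'.
Proof.
move=> AA'; apply: (@complexI R); rewrite -!pencil_det0r.
apply: pencil_det_degenerates => e /AA'[P [detP PA _]]; exists P; split=> // i j.
by rewrite mulmx0 mul0mx !mxE subrr normr0; apply: le_trans (PA i j).
Qed.

(** The one-parameter group diag(t^w_i) multiplies the entry (i, j) of a symmetric
    form by t^(w_i + w_j); these are the entries that it fixes. *)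
Definition weight0_part m (w : 'I_m -> int) (X : 'M[R]_m) :=
  \matrix_(i, j) if w i + w j == 0 then X i j else 0.

(** As t grows, entries of negative weight tend to 0, entries of weight zero are
    fixed, and there are no entries of positive weight to blow up. The condition
    on the sum of the weights puts the one-parameter group in SL_m. *)
Lemma degenerates_weight0_part m (w : 'I_m -> int) (A B : 'M[R]_m) :
    \sum_i w i = 0 ->
    (forall i j, 0 < w i + w j -> A i j = 0 /\ B i j = 0) ->
  degenerates A B (weight0_part w A) (weight0_part w B).
Proof.
move=> sum_w AB_le0 e e0.
have [KA KA0 bA] := exists_bounded_mx A; have [KB KB0 bB] := exists_bounded_mx B.
(* An entry of negative weight becomes at most (KA + KB) / t, and t >= 1 lets the
   weight -1 stand for all negative weights. *)
pose t := 1 + (KA + KB) / e.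
have t1 : 1 <= t by rewrite lerDl divr_ge0 ?addr_ge0 // ltW.
have t0 : 0 < t by apply: lt_le_trans t1.
have tu : t \is a GRing.unit by rewrite unitfE gt_eqF.
have Kt : (KA + KB) / t <= e.
  rewrite ler_pdivrMr // /t mulrDr mulr1 mulrCA divff ?gt_eqF // mulr1.
  by rewrite lerDr ltW.
pose T := diag_mx (\row_i t ^ w i).
have TXT X K : 0 <= K -> K <= KA + KB -> bounded_mx K X ->
    (forall i j, 0 < w i + w j -> X i j = 0) ->
    close_mx e (T *m X *m T^T) (weight0_part w X).
  move=> K0 KK bX X0 i j; rewrite tr_diag_mx mul_diag_mx mul_mx_diag !mxE.
  rewrite mulrAC -expfzDr; last by rewrite gt_eqF.
  case: (ltgtP (w i + w j) 0) => [w_lt0|w_gt0|w0].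
  - rewrite subr0 normrM; apply: le_trans Kt.
    rewrite mulrC; apply: ler_pM => //; first exact: le_trans KK.
    rewrite ger0_norm -?exprN1; last by rewrite exprz_ge0 ?ltW.
    by apply: ler_weXz2l => //; lia.
  - by rewrite X0 // mulr0 subrr normr0 ltW.
  - by rewrite w0 expr0z mul1r subrr normr0 ltW.
exists T; split.
- rewrite det_diag (eq_bigr (fun i => t ^ w i)) => [|i _]; last by rewrite mxE.
  have -> : \prod_i t ^ w i = t ^ (\sum_i w i).
    by elim/big_ind2: _ => [|x1 x2 y1 y2 -> ->|//]; rewrite ?expr0z ?expfzDr ?gt_eqF.
  by rewrite sum_w expr0z.
- by apply: (TXT A KA) => //; [rewrite lerDl | move=> i j /AB_le0[]].
- by apply: (TXT B KB) => //; [rewrite lerDr | move=> i j /AB_le0[]].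
Qed.

End Degeneration.

(** * Pairs with real eigenvalues degenerate to diagonal pairs *)

Section Reduction.
Variable R : rcfType.

Definition real_pencil m (A B : 'M[R]_m) :=
  forall z : R[i], pencil_det z A B = 0 -> z \is Num.real.

Definition diagonal_degeneration m (A B : 'M[R]_m) := exists D1 D2 : 'M[R]_m,
  [/\ is_diag_mx D1, is_diag_mx D2 & degenerates A B D1 D2].

(** Stated with the rank as a variable r, so that it can be applied at a matrix
    size that is only provably equal to the rank. *)
Lemma exists_rowspace_basis (F : fieldType) p q r (M : 'M[F]_(p, q)) :
  \rank M = r -> exists2 U : 'M[F]_(r, q), (U <= M)%MS & row_free U.
Proof.
by move=> <-; exists (row_base M); [rewrite eq_row_base | exact: row_base_free].
Qed.

(** U spans the kernel of x |-> x A V^T, which has dimension n and meets the row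
    space of V trivially because the restriction of A to V is nondegenerate. *)
Lemma exists_orthogonal_complement (F : fieldType) k n (A : 'M[F]_(k + n))
    (V : 'M[F]_(k, k + n)) :
  V *m A *m V^T \in unitmx ->
  exists2 U : 'M[F]_(n, k + n), U *m A *m V^T = 0 & col_mx V U \in unitmx.
Proof.
move=> nsV; have rankAV : \rank (A *m V^T) = k.
  apply/eqP; rewrite eqn_leq rank_leq_col /= -{1}(mxrank_unit nsV) -mulmxA.
  exact: mxrankM_maxr.
have [|U /sub_kermxP kerU freeU] := @exists_rowspace_basis _ _ _ n (kermx (A *m V^T)).
  by rewrite mxrank_ker rankAV addKn.
exists U; first by rewrite -mulmxA.
rewrite -row_free_unit; apply: inj_row_free => v.
rewrite -[v]hsubmxK mul_row_col => vVU.
have v1 : lsubmx v = 0.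
  have := congr1 (fun x => x *m (A *m V^T)) vVU.
  rewrite mul0mx mulmxDl -!mulmxA kerU mulmx0 addr0 (mulmxA V).
  move/(congr1 (mulmx^~ (invmx (V *m A *m V^T)))).
  by rewrite mulmxK // mul0mx.
move: vVU; rewrite v1 mul0mx add0r => /eqP; rewrite mulmx_free_eq0 // => /eqP ->.
by rewrite row_mx0.
Qed.

(** A diagonal factor of any prescribed nonzero determinant exists in positive
    size; in size 0 all determinants are 1 already. *)
Lemma exists_diag_det_mul1 m (Q : 'M[R]_m) : Q \in unitmx ->
  exists s : 'rV_m, \det (diag_mx s *m Q) = 1.
Proof.
rewrite unitmxE unitfE => nzQ; case: m Q nzQ => [|m] Q nzQ.
  by exists 0; rewrite det_mx00.
exists (\row_i if i == ord0 then (\det Q)^-1 else 1).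
rewrite det_mulmx det_diag big_ord_recl big1 ?mxE ?mulr1 ?mulVf // => i _.
by rewrite mxE.
Qed.

(** The determinant of Q is repaired by a diagonal matrix, which keeps the limit
    diagonal. *)
Lemma diagonal_degeneration_congr m (Q A B : 'M[R]_m) : Q \in unitmx ->
  diagonal_degeneration (Q *m A *m Q^T) (Q *m B *m Q^T) -> diagonal_degeneration A B.
Proof.
move=> /exists_diag_det_mul1[s detsQ] [_ [_ [/diag_mxP[d1 ->] /diag_mxP[d2 ->] QD]]].
have diag_congr d : is_diag_mx (diag_mx s *m diag_mx d *m (diag_mx s)^T).
  by rewrite tr_diag_mx !mulmx_diag diag_mx_is_diag.
do 2!eexists; split; last exact: degenerates_congr detsQ QD; exact: diag_congr.
Qed.

Lemma pencil_det_block m n z (A1 B1 : 'M[R]_m) (A2 B2 : 'M[R]_n) :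
  pencil_det z (block_mx A1 0 0 A2) (block_mx B1 0 0 B2) =
  pencil_det z A1 B1 * pencil_det z A2 B2.
Proof.
rewrite /pencil_det !map_block_mx scale_block_mx opp_block_mx add_block_mx.
by rewrite !map_mx0 !scaler0 !subr0 det_ublock.
Qed.

Lemma real_pencil_congr m (Q A B : 'M[R]_m) :
  real_pencil A B -> Q \in unitmx -> real_pencil (Q *m A *m Q^T) (Q *m B *m Q^T).
Proof.
move=> rAB; rewrite unitmxE unitfE => nzQ z; rewrite pencil_det_congr => /eqP.
by rewrite mulf_eq0 expf_eq0 /= fmorph_eq0 (negPf nzQ) => /eqP/rAB.
Qed.

Lemma unitmx_congr m (Q A : 'M[R]_m) :
  Q \in unitmx -> A \in unitmx -> Q *m A *m Q^T \in unitmx.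
Proof. by move=> uQ uA; rewrite !unitmx_mul uQ uA unitmx_tr. Qed.

Lemma trmx_congr m n (Q : 'M[R]_(n, m)) (A : 'M[R]_m) :
  A^T = A -> (Q *m A *m Q^T)^T = Q *m A *m Q^T.
Proof. by move=> sA; rewrite !trmx_mul trmxK sA mulmxA. Qed.

Lemma eigenvalue_pencil_det m (A B : 'M[R]_m) z : A \in unitmx ->
  eigenvalue (map_mx (real_complex R) (invmx A *m B)) z = (pencil_det z A B == 0).
Proof.
move=> uA; pose iota := real_complex R; set C := map_mx _ _.
have uAC : map_mx iota A \in unitmx by rewrite map_unitmx.
have -> : pencil_det z A B = \det (map_mx iota A) * \det (z%:M - C).
  rewrite -det_mulmx mulmxBr mul_mx_scalar -map_mxM mulmxA mulmxV //.
  by rewrite mul1mx.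
move: uAC; rewrite unitmxE unitfE mulf_eq0 => /negPf->.
apply/eigenvalueP/det0P=> -[v].
  by move=> vC v0; exists v; rewrite // mulmxBr mul_mx_scalar vC subrr.
by move=> v0 /eqP; rewrite mulmxBr mul_mx_scalar subr_eq0 => /eqP vC; exists v.
Qed.

(** Some complex root of the pencil exists; it is real by assumption, and then the
    real matrix l A - B is singular. *)
Lemma exists_pencil_eigenvector m (A B : 'M[R]_m.+1) :
    A \in unitmx -> real_pencil A B ->
  exists (l : R) (u : 'rV_m.+1), u != 0 /\ u *m B = l *: (u *m A).
Proof.
move=> uA rAB.
have [z] := eigenvalue_closed (map_mx (real_complex R) (invmx A *m B)) (ltn0Sn m).
rewrite eigenvalue_pencil_det // => /eqP z0.
have /complex_realP[l z_l] := rAB z z0.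
have : \det (l *: A - B) == 0.
  rewrite -(fmorph_eq0 (real_complex R)) -det_map_mx map_mxB map_mxZ.
  by rewrite z_l in z0; apply/eqP.
case/det0P=> u u0 /eqP; rewrite mulmxBr subr_eq0 -scalemxAr => /eqP uB.
by exists l, u.
Qed.

(** Splitting off the nondegenerate line of u: from u B = l u A, everything
    A-orthogonal to u is also B-orthogonal to it. The pencil determinant of the
    pair factors along the splitting, so the complementary block satisfies the
    hypotheses of the induction. *)
Lemma diagonal_degeneration_anisotropic m (A B : 'M[R]_(1 + m)) l (u : 'rV_(1 + m)) :
    (forall A2 B2 : 'M[R]_m, A2^T = A2 -> B2^T = B2 -> A2 \in unitmx ->
       real_pencil A2 B2 -> diagonal_degeneration A2 B2) ->
    A^T = A -> B^T = B -> A \in unitmx -> real_pencil A B ->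
    u *m B = l *: (u *m A) -> u *m A *m u^T != 0 ->
  diagonal_degeneration A B.
Proof.
move=> IH sA sB uA rAB uB uAu.
have ns_uAu : u *m A *m u^T \in unitmx.
  rewrite unitmxE unitfE [u *m A *m u^T]mx11_scalar det_scalar1.
  by apply: contra uAu => /eqP a0; rewrite [_ *m _]mx11_scalar a0 raddf0.
have [U UAu ns_uU] := exists_orthogonal_complement ns_uAu.
have uAU : u *m A *m U^T = 0.
  by apply: trmx_inj; rewrite !trmx_mul trmxK sA mulmxA UAu trmx0.
have uBU : u *m B *m U^T = 0 by rewrite uB -scalemxAl uAU scaler0.
have UBu : U *m B *m u^T = 0.
  by apply: trmx_inj; rewrite !trmx_mul trmxK sB mulmxA uBU trmx0.
pose Q := col_mx u U.
have QXQ X : u *m X *m U^T = 0 -> U *m X *m u^T = 0 ->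
    Q *m X *m Q^T = block_mx (u *m X *m u^T) 0 0 (U *m X *m U^T).
  by move=> <- <-; rewrite tr_col_mx mul_col_mx mul_col_row.
have [] := IH (U *m A *m U^T) (U *m B *m U^T); first exact: trmx_congr.
- exact: trmx_congr.
- have := unitmx_congr ns_uU uA; rewrite QXQ // !unitmxE det_ublock.
  by rewrite unitrM => /andP[].
- move=> z z0; have := real_pencil_congr rAB ns_uU; rewrite !QXQ // => /(_ z).
  by apply; rewrite pencil_det_block z0 mulr0.
move=> D1 [D2 [dD1 dD2 UD]].
apply: (@diagonal_degeneration_congr _ Q) => //; rewrite !QXQ //.
have diag1 (X : 'M[R]_1) : is_diag_mx X by rewrite [X]mx11_scalar scalar_mx_is_diag.
do 2!eexists; split; last exact: degenerates_block (degenerates_refl _ _) UD.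
  by rewrite is_diag_block_mx // !eqxx diag1.
by rewrite is_diag_block_mx // !eqxx diag1.
Qed.

(** The rows of Q are u, a vector w with u A w^T <> 0, and a basis of the
    A-orthogonal of the plane of u and w, on which A is nondegenerate with matrix
    (0, a; a, g). *)
Lemma exists_isotropic_flag m (A : 'M[R]_(1 + 1 + m)) (u : 'rV_(1 + 1 + m)) :
    A^T = A -> A \in unitmx -> u != 0 -> u *m A *m u^T = 0 ->
  exists Q : 'M[R]_(1 + 1 + m), [/\ Q \in unitmx, row ord0 Q = u &
    forall j : 'I_(1 + 1 + m), j != 1%N :> nat -> (u *m A *m Q^T) 0 j = 0].
Proof.
move=> sA uA u0 uAu.
have /rV0Pn[j uAj] : u *m A != 0.
  apply: contra u0 => /eqP/(congr1 (mulmx^~ (invmx A))).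
  by rewrite mulmxK // mul0mx => ->.
pose w : 'rV[R]_(1 + 1 + m) := delta_mx 0 j; pose a := (u *m A) 0 j.
have uAw : u *m A *m w^T = a%:M.
  by rewrite trmx_delta -colE [LHS]mx11_scalar mxE.
have wAu : w *m A *m u^T = a%:M.
  by apply: trmx_inj; rewrite !trmx_mul trmxK sA mulmxA uAw tr_scalar_mx.
have VAV : col_mx u w *m A *m (col_mx u w)^T \in unitmx.
  rewrite tr_col_mx mul_col_mx mul_col_row uAu uAw wAu.
  rewrite -row_free_unit; apply: inj_row_free => v.
  rewrite -[v]hsubmxK mul_row_block mulmx0 add0r !mul_mx_scalar -[RHS]row_mx0.
  case/eq_row_mx=> /eqP; rewrite scaler_eq0 (negPf uAj) => /eqP->.
  rewrite mul0mx addr0 => /eqP; rewrite scaler_eq0 (negPf uAj) => /eqP->.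
  by rewrite row_mx0.
have [U UAV ns_VU] := exists_orthogonal_complement VAV.
have uAU : u *m A *m U^T = 0.
  apply: trmx_inj; rewrite !trmx_mul trmxK sA mulmxA trmx0.
  by move: UAV; rewrite tr_col_mx mul_mx_row -row_mx0 => /eq_row_mx[].
exists (col_mx (col_mx u w) U); split=> //.
  have -> : ord0 = lshift m (lshift 1 (ord0 : 'I_1)) by apply: val_inj.
  by apply: etrans (rowKu (lshift 1 ord0) _ _) _; rewrite rowKu row_id.
move=> i; rewrite 2!tr_col_mx !mul_mx_row uAu uAw uAU -[ i]splitK.
case: (fintype.split i) => [i'|k _] /=; last by rewrite row_mxEr mxE.
rewrite row_mxEl -[i']splitK; case: (fintype.split i') => k /=.
  by rewrite row_mxEl mxE.
by rewrite ord1.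
Qed.

(** The weights of the one-parameter group diag(t, 1/t, 1, ..., 1). *)
Definition hyperbolic_weight m (i : 'I_m) : int :=
  if i == 0%N :> nat then 1 else if i == 1%N :> nat then -1 else 0.

Lemma trmx_weight0_part m (w : 'I_m -> int) (X : 'M[R]_m) :
  X^T = X -> (weight0_part w X)^T = weight0_part w X.
Proof. by move=> sX; apply/matrixP => i j; rewrite !mxE addrC -{1}sX mxE. Qed.

Lemma degenerates_real_pencil m (A B A' B' : 'M[R]_m) :
  degenerates A B A' B' -> real_pencil A B -> real_pencil A' B'.
Proof. by move=> AA' rAB z z0; apply: rAB; rewrite (pencil_det_degenerates z AA'). Qed.

Lemma degenerates_unitmx m (A B A' B' : 'M[R]_m) :
  degenerates A B A' B' -> A \in unitmx -> A' \in unitmx.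
Proof. by move=> AA'; rewrite !unitmxE (det_degenerates AA'). Qed.

(** In the basis of [exists_isotropic_flag] the first rows of A and B, the second
    being l times the first, vanish outside column 1. So no entry has positive
    weight, and in the limit the rows 0 and 1 of A' have a single nonzero entry
    a, in columns 1 and 0; those of B' are l times them. Hence v = e_0 + e_1
    satisfies v B' = l v A' and v A' v^T = 2 a. *)
Lemma isotropic_degenerates_anisotropic m (A B : 'M[R]_(1 + 1 + m)) (l : R)
    (u : 'rV_(1 + 1 + m)) :
    A^T = A -> B^T = B -> A \in unitmx -> u != 0 ->
    u *m B = l *: (u *m A) -> u *m A *m u^T = 0 ->
  exists Q A' B' : 'M[R]_(1 + 1 + m), exists v : 'rV_(1 + 1 + m),
    [/\ Q \in unitmx, degenerates (Q *m A *m Q^T) (Q *m B *m Q^T) A' B',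
        A'^T = A' /\ B'^T = B', v *m B' = l *: (v *m A') & v *m A' *m v^T != 0].
Proof.
move=> sA sB uA u0 uB uAu.
have [Q [uQ row0Q uAQ]] := exists_isotropic_flag sA uA u0 uAu.
have row0 X j : (Q *m X *m Q^T) ord0 j = (u *m X *m Q^T) 0 j.
  by rewrite -row0Q -!row_mul [RHS]mxE.
(* A1 and B1 are opaque, so that [mxE] does not expand the products. *)
have [A1 A1E] : exists A1, A1 = Q *m A *m Q^T by eexists.
have [B1 B1E] : exists B1, B1 = Q *m B *m Q^T by eexists.
have A1_0 (j : 'I_(1 + 1 + m)) : j != 1%N :> nat -> A1 ord0 j = 0.
  by move=> j1; rewrite A1E row0 uAQ.
have B1_A1 j : B1 ord0 j = l * A1 ord0 j.
  by rewrite A1E B1E !row0 uB -!scalemxAl mxE.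
have sA1 : A1^T = A1 by rewrite A1E; apply: trmx_congr.
have sB1 : B1^T = B1 by rewrite B1E; apply: trmx_congr.
have A1C i j : A1 i j = A1 j i by rewrite -{1}sA1 mxE.
have B1C i j : B1 i j = B1 j i by rewrite -{1}sB1 mxE.
pose i1 : 'I_(1 + 1 + m) := lift ord0 ord0.
have a0 : A1 ord0 i1 != 0.
  have /rV0Pn[j] : u *m A *m Q^T != 0.
    apply: contra u0 => /eqP/(congr1 (mulmx^~ (invmx Q^T *m invmx A))).
    by rewrite mul0mx mulmxA !mulmxK ?unitmx_tr // => ->.
  rewrite -row0 -A1E; case: (eqVneq (nat_of_ord j) 1%N) => [j1|/A1_0 -> /eqP//].
  by have -> : j = i1 by apply: val_inj.
pose w := @hyperbolic_weight (1 + 1 + m).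
have w_ord0 : w ord0 = 1 by [].
have w_i1 : w i1 = -1 by [].
have pos_w (X : 'M[R]_(1 + 1 + m)) : (forall i j, X i j = X j i) ->
    (forall j : 'I_(1 + 1 + m), j != 1%N :> nat -> X ord0 j = 0) ->
    forall i j, 0 < w i + w j -> X i j = 0.
  move=> XC X0 i j; rewrite {1 2}/w /hyperbolic_weight.
  case: (eqVneq (nat_of_ord i) 0%N) => [i0|iN0];
    last case: (eqVneq (nat_of_ord j) 0%N) => [j0|jN0].
  - have -> : i = ord0 by apply: val_inj.
    by move=> wij; apply: X0; apply: contraTneq wij => ->.
  - have -> : j = ord0 by apply: val_inj.
    by move=> wij; rewrite XC; apply: X0; apply: contraTneq wij => ->.
  - by do 2!case: ifP => _.
exists Q, (weight0_part w A1), (weight0_part w B1), (delta_mx 0 ord0 + delta_mx 0 i1).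
rewrite -A1E -B1E; split=> //.
- apply: degenerates_weight0_part => [|i j wij].
    by rewrite !big_ord_recl big1 // => i _; rewrite /w /hyperbolic_weight.
  split; first exact: pos_w.
  by apply: (pos_w B1) => // k k1; rewrite B1_A1 A1_0 // mulr0.
- by split; apply: trmx_weight0_part.
- rewrite !mulmxDl scalerDr -!rowE; apply/rowP => j; rewrite !mxE w_ord0 w_i1.
  rewrite B1_A1; case: (eqVneq (nat_of_ord j) 0%N) => [j0|jN0].
    have -> : j = ord0 by apply: val_inj.
    by rewrite w_ord0 /= (B1C i1) B1_A1 (A1C i1) !mulr0.
  case: (eqVneq (nat_of_ord j) 1%N) => [j1|jN1].
    have -> : j = i1 by apply: val_inj.
    by rewrite w_i1 /= mulr0.
  have -> : w j = 0 by rewrite /w /hyperbolic_weight (negPf jN0) (negPf jN1).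
  by rewrite /= mulr0.
rewrite linearD /= mulmxDl mulmxDr !mulmxDl -!rowE !trmx_delta -!colE.
apply/eqP => /matrixP/(_ 0 0)/eqP; rewrite !mxE w_ord0 w_i1 /= add0r addr0.
by rewrite (A1C i1) -mulr2n mulrn_eq0 (negPf a0).
Qed.

Theorem diagonal_degeneration_of_real_pencil m (A B : 'M[R]_m) :
    A^T = A -> B^T = B -> A \in unitmx -> real_pencil A B ->
  diagonal_degeneration A B.
Proof.
elim: m A B => [|m IHm] A B sA sB uA rAB.
  by exists A, B; split; [| |exact: degenerates_refl]; apply/is_diag_mxP => -[].
have [l [u [u0 uB]]] := exists_pencil_eigenvector uA rAB.
case: (eqVneq (u *m A *m u^T) 0) => [uAu|]; last first.
  exact: (@diagonal_degeneration_anisotropic m A B l u).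
case: m IHm A B sA sB uA rAB u u0 uB uAu => [|m] IHm A B sA sB uA rAB u u0 uB uAu.
  (* In size 1, a nonzero vector is anisotropic for the nonsingular A. *)
  case/eqP: u0; have [a uE] : exists a, u = a%:M by exists (u 0 0); apply: mx11_scalar.
  move: uAu; rewrite uE tr_scalar_mx mul_scalar_mx mul_mx_scalar => /eqP.
  rewrite !scaler_eq0; case: (eqVneq a 0) => [-> _|_ /=]; first exact: raddf0.
  by move=> /eqP A0; move: uA; rewrite A0 unitmxE det0 unitr0.
have [Q [A' [B' [v [uQ AA' [sA' sB'] vB' vA'v]]]]] :=
  isotropic_degenerates_anisotropic sA sB uA u0 uB uAu.
have [||D1 [D2 [dD1 dD2 A'D]]] :=
  diagonal_degeneration_anisotropic IHm sA' sB' _ _ vB' vA'v.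
- exact: degenerates_unitmx AA' (unitmx_congr uQ uA).
- exact: degenerates_real_pencil AA' (real_pencil_congr rAB uQ).
apply: (diagonal_degeneration_congr uQ); exists D1, D2; split=> //.
exact: degenerates_trans AA' A'D.
Qed.

End Reduction.

(** * Weak simultaneous diagonalizability *)

Lemma only_real_eigenvalues_pencil (R : realType) m (A B : 'M[R]_m) :
  A \in unitmx -> only_real_eigenvalues (invmx A *m B) <-> real_pencil A B.
Proof.
move=> uA; split=> rAB z => [z0|]; last first.
  by rewrite eigenvalue_pencil_det // => /eqP; apply: rAB.
by apply: rAB; rewrite eigenvalue_pencil_det // z0.
Qed.

Lemma frobenius_norm_sqr (R : realType) m n (M : 'M[R]_(m, n)) :
  frobenius_norm M ^+ 2 = \sum_i \sum_j M i j ^+ 2.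
Proof.
rewrite sqr_sqrtr //; apply: sumr_ge0 => i _; apply: sumr_ge0 => j _.
exact: sqr_ge0.
Qed.

Lemma normr_le_frobenius_norm (R : realType) m n (M : 'M[R]_(m, n)) i j :
  `|M i j| <= frobenius_norm M.
Proof.
rewrite -sqrtr_sqr ler_wsqrtr // (bigD1 i) //= (bigD1 j) //= -addrA lerDl.
rewrite addr_ge0 ?sumr_ge0 // => *; rewrite ?sqr_ge0 // sumr_ge0 // => *.
by rewrite sqr_ge0.
Qed.

Lemma frobenius_norm_sqr_le (R : realType) m n (M : 'M[R]_(m, n)) (e : R) :
  bounded_mx e M -> frobenius_norm M ^+ 2 <= (m * n)%:R * e ^+ 2.
Proof.
move=> bM; rewrite frobenius_norm_sqr natrM -mulrA mulr_natl -[m in _ *+ m]card_ord.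
rewrite -sumr_const ler_sum // => i _; rewrite mulr_natl -[n in _ *+ n]card_ord.
rewrite -sumr_const ler_sum // => j _.
by rewrite -real_normK ?num_real // ler_pXn2r ?nnegrE // (le_trans _ (bM i j)).
Qed.

(** If det (z A - B) = 0, closeness of P_k A P_k^T and P_k B P_k^T to D_k within e
    gives |Im z|^m |det D_k^(1)| <= |det (z D_k^(1) - D_k^(2))| <= C e, while
    det D_k^(1) is within C' e of det A; as e tends to 0, Im z = 0. The
    uniform bound on the D_k makes C and C' independent of k. *)
Lemma TWSDB_real_pencil (R : realType) m (A B : 'M[R]_m) :
  A \in unitmx -> TWSDB [tuple A; B] -> real_pencil A B.
Proof.
move=> uA [P [D [detP diagD PD0 [M DM]]]] z z0.
have [K K0 DK] : exists2 K : R, 0 <= K & forall k i, bounded_mx K (D k i).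
  exists `|M| => // k i a b.
  exact: le_trans (normr_le_frobenius_norm _ _ _) (le_trans (DM k i) (ler_norm _)).
have approx e : 0 < e -> exists k,
    close_mx e (P k *m A *m (P k)^T) (D k ord0) /\
    close_mx e (P k *m B *m (P k)^T) (D k (lift ord0 ord0)).
  move=> e0; have e20 : 0 < e ^+ 2 by rewrite exprn_gt0.
  have /cvgr0_norm_lt/(_ _ e20)[k _ /(_ k (leqnn k))] := PD0.
  rewrite /= big_ord_recl big_ord1 => small; exists k.
  have close_of (X Y : 'M[R]_m) r : 0 <= r ->
      `|frobenius_norm (X - Y) ^+ 2 + r| < e ^+ 2 -> close_mx e X Y.
    move=> r0; rewrite ger0_norm ?addr_ge0 ?sqr_ge0 // => lt_e i j.
    have := normr_le_frobenius_norm (X - Y) i j; rewrite !mxE => /le_trans; apply.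
    rewrite -(@ler_pXn2r _ 2) ?nnegrE ?sqrtr_ge0 ?(ltW e0) //.
    by rewrite (le_trans _ (ltW lt_e)) // lerDl.
  split; first by apply: close_of small; rewrite sqr_ge0.
  by rewrite addrC in small; apply: close_of small; rewrite sqr_ge0.
have K1 : 0 <= K + 1 by rewrite addr_ge0.
have KK1 : K <= K + 1 by rewrite lerDl.
have [C lipC] := pencil_det_lipschitz m z K1.
have [C' C'0 lipC'] := det_lipschitz m K1.
have Im0 : `|complex.Im z| ^+ m * `|\det A| <= 0.
  apply: (@le0_of_le_scaled_eps _ _ (C + `|complex.Im z| ^+ m * C')) => e e0 e1.
  have [k [PA PB]] := approx _ e0.
  have bound X i : close_mx e X (D k i) -> bounded_mx (K + 1) X.
    by move=> /(bounded_close_mx (DK k i)); apply: bounded_mxW; rewrite lerD2l.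
  have bD i : bounded_mx (K + 1) (D k i) by apply: bounded_mxW (DK k i).
  have det_small : `|\det A - \det (D k ord0)| <= C' * e.
    have -> : \det A = \det (P k *m A *m (P k)^T).
      by rewrite !det_mulmx det_tr detP mul1r mulr1.
    by apply: lipC' => //; apply: bound PA.
  have pencil_small : `|complex.Im z| ^+ m * `|\det (D k ord0)| <= C * e.
    rewrite -lecR.
    apply: le_trans (pencil_det_diag z (diagD k ord0) (diagD k (lift ord0 ord0))) _.
    rewrite -[pencil_det _ _ _]opprK normrN -[- _]add0r.
    have <- : pencil_det z (P k *m A *m (P k)^T) (P k *m B *m (P k)^T) = 0.
      by rewrite pencil_det_congr z0 mulr0.
    by apply: lipC => //; [apply: bound PA | apply: bound PB].
  rewrite mulrDl -mulrA; apply: le_trans (lerD pencil_small (ler_wpM2l _ det_small)).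
    by rewrite -mulrDr ler_wpM2l ?exprn_ge0 // addrC -lerBlDr lerB_dist.
  exact: exprn_ge0.
move: Im0; rewrite -normrX -normrM normr_le0 mulf_eq0 expf_eq0.
move: uA; rewrite unitmxE unitfE => /negPf ->; rewrite orbF => /andP[_].
by case: z {z0 C lipC} => a b /= b0; rewrite complex_real.
Qed.

(** The diagonal matrices can be taken constant in k, which makes their
    boundedness automatic. *)
Lemma real_pencil_TWSDB (R : realType) m (A B : 'M[R]_m) :
  A^T = A -> B^T = B -> A \in unitmx -> real_pencil A B -> TWSDB [tuple A; B].
Proof.
move=> sA sB uA rAB.
have [D1 [D2 [dD1 dD2 AD]]] := diagonal_degeneration_of_real_pencil sA sB uA rAB.
have harm_gt0 k : 0 < harmonic k :> R by rewrite /harmonic invr_gt0.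
have [P PP] := choice (fun k => AD _ (harm_gt0 k)).
exists P, (fun _ => tnth [tuple D1; D2]); split.
- by move=> k; have [] := PP k.
- by move=> k i; case: (unliftP ord0 i) => [j|] ->; rewrite (tnth_nth 0) //= ?ord1.
- pose c : R := (m * m)%:R.
  have sq_harm : ((fun k => (c + c) * (@harmonic R k * harmonic k)) @ \oo --> 0)%classic.
    rewrite -[X in (_ --> X)%classic](mulr0 (c + c)) -[X in _ * X](mulr0 0).
    by apply: cvgM; [exact: cvg_cst | apply: cvgM; exact: cvg_harmonic].
  apply: (squeeze_cvgr _ (@cvg_cst _ 0 _ _ _) sq_harm).
  apply: nearW => k; rewrite sumr_ge0 /=; last by move=> *; rewrite sqr_ge0.
  have [_ PA PB] := PP k; rewrite big_ord_recl big_ord1.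
  rewrite mulrDl -expr2; by apply: lerD; apply: frobenius_norm_sqr_le; apply: bounded_mxB.
exists (frobenius_norm D1 + frobenius_norm D2) => k i.
case: (unliftP ord0 i) => [j|] ->; rewrite (tnth_nth 0) //= ?ord1.
  by rewrite lerDr sqrtr_ge0.
by rewrite lerDl sqrtr_ge0.
Qed.

Theorem theorem3p8 (R : realType) (m : nat) (A B : 'M[R]_m)
    (symA : A^T = A) (symB : B^T = B) (nsA : A \in unitmx) :
  TWSDB [tuple A; B] <-> only_real_eigenvalues (invmx A *m B).
Proof.
split=> [/(TWSDB_real_pencil nsA)|/(only_real_eigenvalues_pencil B nsA)].
  by move/(only_real_eigenvalues_pencil B nsA).
exact: real_pencil_TWSDB.
Qed.
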